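(* Let $l,l'\ge 1$ be natural numbers, let $r_1,\dots,r_l\in\mathbb{C}$ and let $s_1,\dots,s_{l'}\in\mathbb{C}\setminus\{0\}$. Let $\mathbb{B}=\mathbb{B}(r_1,\dots,r_l;s_1,\dots,s_{l'})$, acting as a bounded linear operator on $c_0$. Then $$\{r_1,r_2,\dots,r_l\}\subseteq III_1\sigma(\mathbb{B},c_0).$$
   Context: $c_0$ is the Banach space of complex sequences $x=(x_k)_{k\ge 0}$ converging to $0$, with the supremum norm. For an integer $a$ and $n\in\mathbb{N}$, $a\,(\mathrm{mod}\ n)$ denotes the remainder in $\{0,\dots,n-1\}$ of $a$ modulo $n$. The matrix $\mathbb{B}(r_1,\dots,r_l;s_1,\dots,s_{l'})=(b_{ij})_{i,j\ge 0}$ is the infinite lower triangular matrix with $b_{ij}=r_{j(\mathrm{mod}\ l)+1}$ if $i=j$, $b_{ij}=s_{j(\mathrm{mod}\ l')+1}$ if $i=j+1$, and $b_{ij}=0$ otherwise; it acts on $x=(x_k)_{k\ge0}$ by $(\mathbb{B}x)_k=s_{(k-1)(\mathrm{mod}\ l')+1}x_{k-1}+r_{k(\mathrm{mod}\ l)+1}x_k$, with $x_{-1}=0$. In Goldberg's classification, $III_1\sigma(T,X)$ is the set of $\lambda\in\mathbb{C}$ such that the range of $T-\lambda I$ is not dense in $X$, and $T-\lambda I$ is injective with bounded inverse $(T-\lambda I)^{-1}$ on its range. *)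

(* Defs.v *)
From HB Require Import structures.
From mathcomp Require Import all_boot all_order all_algebra.
From mathcomp Require Import complex.
From mathcomp Require Import boolp classical_sets functions reals.
From mathcomp Require Import topology normedtype sequences.

Set Implicit Arguments.
Unset Strict Implicit.
Unset Printing Implicit Defensive.

Import Order.TTheory GRing.Theory Num.Theory.
Import numFieldNormedType.Exports.

Local Open Scope classical_set_scope.
Local Open Scope complex_scope.
Local Open Scope ring_scope.

(* Goldberg's class III_1: the state III ("the range is not dense") together
   with the state 1 ("injective with bounded inverse on the range").  A map g
   such that [cancel S g] restricts to the inverse of S on [range S]; its
   values outside of [range S] are irrelevant. *)
Definition III1_sigma (K : numFieldType) (X : normedModType K)
    (T : {linear X -> X}) : set K :=
  [set lambda | let S := fun x : X => T x - lambda *: x in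
    [/\ ~ dense (range S),
        injective S &
        exists g : X -> X, cancel S g /\
          exists M : K, forall y, range S y -> `|g y| <= M * `|y|]].

Section null_sequences.
Variable K : numFieldType.

Definition null_seq : {pred nat -> K^o} :=
  mem [set x : nat -> K^o | x @ \oo --> (0 : K^o)].

Lemma null_seqP (x : nat -> K^o) :
  reflect (x @ \oo --> (0 : K^o)) (x \in null_seq).
Proof. by apply: (iffP idP); rewrite inE. Qed.

Lemma null_seq_submod_closed : submod_closed null_seq.
Proof.
split; first by apply/null_seqP; exact: (@cvg_cst K^o).
move=> a x y /null_seqP x0 /null_seqP y0; apply/null_seqP.
have : (a *: x + y) @ \oo --> a *: (0 : K^o) + (0 : K^o).
  by apply: (@cvgD K K^o) => //; apply: (@cvgZl_tmp K K^o).
by rewrite scaler0 addr0.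
Qed.

Lemma null_seq_bounded (x : nat -> K^o) : x \in null_seq ->
  exists M : K, forall k, `|x k| <= M.
Proof.
move=> /null_seqP x0.
have /(@cvg_seq_bounded K K^o) : cvgn x by apply/cvg_ex; exists 0.
move=> /pinfty_ex_gt0[M _ Mx]; exists M => k; exact: Mx.
Qed.

HB.instance Definition _ :=
  GRing.isSubmodClosed.Build K (nat -> K^o) null_seq null_seq_submod_closed.

End null_sequences.

Section c0_space.
Variable R : realType.

Record c0 :=
  C0 { c0_val :> nat -> R[i]^o ; c0_valP : c0_val \in @null_seq R[i] }.

HB.instance Definition _ := [isSub for c0_val].
HB.instance Definition _ := [Choice of c0 by <:].
HB.instance Definition _ := [SubChoice_isSubLmodule of c0 by <:].

(* A normed module over [R[i]] has a norm with values in [R[i]], hence the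
   cast of the real number sup_k |x_k|. *)
Definition c0_norm (x : c0) : R[i] :=
  (sup (range (fun k => complex.Re `|x k|)))%:C.

Lemma c0_normP (x : c0) (M : R[i]) :
  c0_norm x <= M <-> forall k, `|x k| <= M.
Proof.
have normRe k : (complex.Re `|x k|)%:C = `|x k| by rewrite RRe_real ?normr_real.
have [N xN] := null_seq_bounded (c0_valP x).
have N_ge0 : 0 <= N := le_trans (normr_ge0 _) (xN 0).
have supx : has_sup (range (fun k => complex.Re `|x k|)).
  split; first by exists (complex.Re `|x 0%N|), 0%N.
  exists (complex.Re N) => _ [k _ <-].
  by rewrite -lecR normRe RRe_real ?ger0_real.
split=> [xM k|xM].
  apply: le_trans xM; rewrite -normRe lecR.
  by apply: sup_upper_bound => //; exists k.
have M_ge0 : 0 <= M := le_trans (normr_ge0 _) (xM 0).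
rewrite -[M]RRe_real ?ger0_real// lecR; apply: ge_sup; first by case: supx.
by move=> _ [k _ <-]; rewrite -lecR normRe RRe_real ?ger0_real.
Qed.

Lemma c0_coord_le (x : c0) (k : nat) : `|x k| <= c0_norm x.
Proof. exact: (c0_normP x (c0_norm x)).1. Qed.

Let c0_normD (x y : c0) : c0_norm (x + y) <= c0_norm x + c0_norm y.
Proof.
apply/c0_normP => k; apply: le_trans (ler_normD (x k) (y k)) _.
by apply: lerD; exact: c0_coord_le.
Qed.

Let c0_norm_ge0 (x : c0) : 0 <= c0_norm x.
Proof. exact: le_trans (normr_ge0 _) (c0_coord_le x 0). Qed.

Let c0_normZ_le (a : R[i]) (x : c0) : c0_norm (a *: x) <= `|a| * c0_norm x.
Proof.
apply/c0_normP => k; rewrite -[_ k]/(a * x k) normrM.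
by apply: ler_wpM2l => //; exact: c0_coord_le.
Qed.

Let c0_norm0_eq0 (x : c0) : c0_norm x = 0 -> x = 0.
Proof.
move=> x0; apply: val_inj; apply/funext => k.
by apply/eqP; rewrite -normr_le0 -x0; exact: c0_coord_le.
Qed.

Let c0_normZ (a : R[i]) (x : c0) : c0_norm (a *: x) = `|a| * c0_norm x.
Proof.
apply/eqP; rewrite eq_le c0_normZ_le/=.
have [->|a0] := eqVneq a 0; first by rewrite normr0 mul0r.
rewrite -ler_pdivlMl ?normr_gt0// -normfV.
by apply: le_trans (c0_normZ_le _ _); rewrite scalerA mulVf// scale1r.
Qed.

HB.instance Definition _ :=
  Lmodule_isNormed.Build R[i] c0 c0_normD c0_normZ c0_norm0_eq0.

Lemma c0_normE (x : c0) :
  `|x| = (sup (range (fun k => complex.Re `|x k|)))%:C.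
Proof. by []. Qed.

End c0_space.

Section band_matrix.
Variables (K : numFieldType) (l l' : nat) (r : l.-tuple K) (s : l'.-tuple K).

(* Tuples are indexed from 0, so that [r`_(j %% l)] is r_{j(mod l)+1}. *)
Definition Bmx (i j : nat) : K :=
  if i == j then r`_(j %% l)
  else if i == j.+1 then s`_(j %% l') else 0.

(* The row sums run over j <= k only, since the matrix is lower triangular. *)
Definition Bact (x : nat -> K^o) : nat -> K^o :=
  fun k => \sum_(j < k.+1) Bmx k j * x j.

Lemma Bact0 (x : nat -> K^o) : Bact x 0 = r`_(0 %% l) * x 0%N.
Proof. by rewrite /Bact big_ord1. Qed.

Lemma BactS (x : nat -> K^o) (k : nat) :
  Bact x k.+1 = s`_(k %% l') * x k + r`_(k.+1 %% l) * x k.+1.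
Proof.
rewrite /Bact big_ord_recr big_ord_recr/= big1 => [|j _].
  by rewrite add0r /Bmx !eqxx (gtn_eqF (ltnSn k)).
by rewrite /Bmx eqSS !gtn_eqF ?mul0r// ltnS ltnW.
Qed.

Lemma Bact_linear a (x y : nat -> K^o) : Bact (a *: x + y) = a *: Bact x + Bact y.
Proof.
apply/funext => k; rewrite /Bact -[RHS]/(a * _ + _) mulr_sumr -big_split/=.
apply: eq_bigr => j _; rewrite mulrCA -mulrDr.
by congr (_ * _).
Qed.

Definition Bbound : K := \sum_(z <- s) `|z| + \sum_(z <- r) `|z|.

Let nth_le n (t : n.-tuple K) (j : nat) : `|t`_j| <= \sum_(z <- t) `|z|.
Proof.
have [jt|jt] := ltnP j (size t); last by rewrite nth_default// normr0 sumr_ge0.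
by rewrite (big_rem _ (mem_nth 0 jt))/= lerDl sumr_ge0.
Qed.

Lemma Bbound_ge0 : 0 <= Bbound.
Proof. by rewrite addr_ge0// sumr_ge0. Qed.

Lemma BactS_le (x : nat -> K^o) (k : nat) (e : K) :
  `|x k| <= e -> `|x k.+1| <= e -> `|Bact x k.+1| <= Bbound * e.
Proof.
move=> xk xk1; rewrite BactS mulrDl; apply: le_trans (ler_normD _ _) _.
by rewrite !normrM lerD// ler_pM.
Qed.

Lemma Bact_le (x : nat -> K^o) (e : K) :
  (forall k, `|x k| <= e) -> forall k, `|Bact x k| <= Bbound * e.
Proof.
move=> xe [|k]; last exact: BactS_le.
rewrite Bact0 normrM ler_pM// /Bbound; apply: le_trans (nth_le _ _) _.
by rewrite lerDr sumr_ge0.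
Qed.

Lemma Bact_null (x : nat -> K^o) : x \in @null_seq K -> Bact x \in @null_seq K.
Proof.
move=> /null_seqP x0; apply/null_seqP.
apply/(@cvgr0Pnorm_le K K^o) => e e0.
have B1 : 0 < Bbound + 1 by rewrite ltr_wpDl ?Bbound_ge0.
have /(@cvgr0Pnorm_le K K^o) /(_ _ (divr_gt0 e0 B1)) [N _ xN] := x0.
exists N.+1 => // -[//|k] /= Nk.
apply: le_trans (BactS_le (xN k Nk) (xN k.+1 (leqW Nk))) _.
rewrite mulrCA ger_pMr// ler_pdivrMr// mul1r lerDl//.
Qed.

End band_matrix.

Section band_operator.
Variables (R : realType) (l l' : nat) (r : l.-tuple R[i]) (s : l'.-tuple R[i]).

Definition Bop (x : c0 R) : c0 R := C0 (Bact_null r s (c0_valP x)).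

Let Bop_linear : linear Bop.
Proof. by move=> a x y; apply: val_inj; exact: Bact_linear. Qed.

HB.instance Definition _ :=
  GRing.isLinear.Build R[i] (c0 R) (c0 R) _ Bop Bop_linear.

Lemma Bop_bounded (x : c0 R) : `|Bop x| <= Bbound r s * `|x|.
Proof. by apply/c0_normP; apply: Bact_le => k; exact: c0_coord_le. Qed.

Lemma Bop_continuous : continuous Bop.
Proof.
apply/bounded_linear_continuous/linear_boundedP.
near=> M => x; apply: le_trans (Bop_bounded x) _; apply: ler_wpM2r => //.
near: M; apply: nbhs_pinfty_ge; rewrite ger0_real ?Bbound_ge0//.
Unshelve. all: by end_near. Qed.

End band_operator.

(* Main.v *)
(** Let [lambda = r_m].  Row [k.+1] of [B - lambda] reads
    [y_{k+1} = s_k x_k + (r_{k+1} - lambda) x_{k+1}], where the last term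
    vanishes whenever [k.+1 = m %[mod l]].  Hence any [x_k] is recovered from
    [y] by solving backwards from the next such index, which is at most [l]
    steps away: [B - lambda] is bounded below.  On the other hand
    [r_m - lambda = 0] makes the top left [(m+1) x (m+1)] block singular, so a
    functional supported on the coordinates [0..m] kills the range. *)
Require Import Defs.
From mathcomp Require Import all_boot all_order all_algebra.
From mathcomp Require Import complex.
From mathcomp Require Import boolp classical_sets functions reals.
From mathcomp Require Import topology normedtype sequences.

Import Order.TTheory GRing.Theory Num.Theory.
Import numFieldNormedType.Exports.

Local Open Scope classical_set_scope.
Local Open Scope complex_scope.
Local Open Scope ring_scope.

Lemma le_sum_mem (K : numDomainType) (T : eqType) (f : T -> K) (t : seq T) z :
  (forall x, 0 <= f x) -> z \in t -> f z <= \sum_(x <- t) f x.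
Proof. by move=> f0 zt; rewrite (big_rem _ zt)/= lerDl sumr_ge0. Qed.

Lemma mem_nth_mod (V : nmodType) n (t : n.-tuple V) k :
  (0 < n)%N -> t`_(k %% n) \in t.
Proof. by move=> n0; rewrite mem_nth// size_tuple ltn_mod. Qed.

(** By linearity, the lower bound applied to [x - y] forces [x = y] whenever [S x = S y]. Applied to
    a preimage of [y], the same bound is the norm bound for the inverse. *)
Lemma bounded_below_inverse (K : numFieldType) (X : normedModType K)
    (T : {linear X -> X}) (lambda M : K) :
  let S := fun x : X => T x - lambda *: x in
  (forall x, `|x| <= M * `|S x|) ->
  injective S /\ exists g : X -> X, cancel S g /\
    exists M : K, forall y, range S y -> `|g y| <= M * `|y|.
Proof.
move=> S SM.
have Sinj : injective S.
  move=> x y Sxy; apply/eqP; rewrite -subr_eq0 -normr_le0.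
  apply: le_trans (SM _) _.
  suff -> : S (x - y) = S x - S y by rewrite Sxy subrr normr0 mulr0.
  by rewrite /S linearB scalerBr opprD addrACA -opprD.
(* Guarding the equation by [range S y] makes [g] total: outside the range any value will do. *)
have /choice[g Hg] : forall y, exists x, range S y -> S x = y.
  by move=> y; have [[x _ <-]|/[dup] ? _] := EM (range S y); [exists x|exists 0].
have gS y : range S y -> S (g y) = y by exact: Hg.
split => //; exists g; split.
  by move=> x; apply: Sinj; apply: gS; exists x.
by exists M => y /gS {2}<-; exact: SM.
Qed.

Section band_operator_at_diagonal_entry.
Variables (R : realType) (l l' : nat) (r : l.-tuple R[i]) (s : l'.-tuple R[i]).
Variable m : nat.
Hypotheses (l'_gt0 : (0 < l')%N) (s_neq0 : forall j : 'I_l', tnth s j != 0).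
Hypothesis m_lt : (m < l)%N.

Let lambda := r`_m.
Let S (x : c0 R) : c0 R := Bop r s x - lambda *: x.

Let l_gt0 : (0 < l)%N. Proof. exact: leq_ltn_trans m_lt. Qed.

Lemma BopB0 (x : c0 R) : S x 0%N = (r`_(0 %% l) - lambda) * x 0%N.
Proof. by rewrite mulrBl -(Bact0 r s). Qed.

Lemma BopBS (x : c0 R) (k : nat) :
  S x k.+1 = s`_(k %% l') * x k + (r`_(k.+1 %% l) - lambda) * x k.+1.
Proof. by rewrite mulrBl addrA -(BactS r s). Qed.

Lemma nth_mod_neq0 k : s`_(k %% l') != 0.
Proof. by have /tnthP[j ->] := mem_nth_mod _ _ s k l'_gt0. Qed.

(** Induction on the distance [d] from [k.+1] to an index congruent to [m]. The constant depends on
    [d] alone, so it is uniform in [x] and [k]. *)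
Lemma coord_bound d : exists M : R[i], 0 <= M /\
  forall (x : c0 R) k, ((k.+1 + d) %% l)%N = m -> `|x k| <= M * `|S x|.
Proof.
(* Sums over the finitely many entries stand in for maxima. *)
pose C : R[i] := \sum_(z <- s) `|z|^-1.
pose D : R[i] := \sum_(z <- r) `|z - lambda|.
have Cs k : `|s`_(k %% l')|^-1 <= C.
  apply: (le_sum_mem _ _ (fun z : R[i] => `|z|^-1) s _ _
    (mem_nth_mod _ _ s k l'_gt0)).
  by move=> z; rewrite invr_ge0.
have Dr k : `|r`_(k %% l) - lambda| <= D.
  by apply: (le_sum_mem _ _ (fun z : R[i] => `|z - lambda|) r _ _
    (mem_nth_mod _ _ r k l_gt0)).
have C0 : 0 <= C by apply: sumr_ge0 => z _; rewrite invr_ge0.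
have D0 : 0 <= D by apply: sumr_ge0.
(* Row [k.+1] solved for [x k]: a bound on its diagonal term carries over to [x k]. *)
have step (x : c0 R) k e : `|(r`_(k.+1 %% l) - lambda) * x k.+1| <= e * `|S x| ->
    `|x k| <= C * (1 + e) * `|S x|.
  move=> xe; have sk := nth_mod_neq0 k.
  have -> : x k = (s`_(k %% l'))^-1 *
      (S x k.+1 - (r`_(k.+1 %% l) - lambda) * x k.+1).
    by rewrite BopBS addrK mulKf.
  rewrite normrM normfV -mulrA; apply: ler_pM => //; first by rewrite invr_ge0.
  apply: le_trans (ler_normB _ _) _.
  by rewrite [leRHS]mulrDl mul1r lerD// c0_coord_le.
elim: d => [|d [M [M0 IH]]].
  (* At distance 0 the diagonal term vanishes, hence [e = 0] in [step]. *)
  exists (C * (1 + 0)); split; first by rewrite addr0 mulr1.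
  move=> x k; rewrite addn0 => km; apply: step.
  by rewrite km subrr mul0r normr0 mul0r.
exists (C * (1 + D * M)); split; first by rewrite mulr_ge0// addr_ge0// mulr_ge0.
move=> x k km; apply: step; rewrite normrM -mulrA ler_pM// ?Dr//.
by apply: IH; rewrite addSnnS.
Qed.

Lemma BopB_bounded_below : exists M : R[i], forall x, `|x| <= M * `|S x|.
Proof.
have [M HM] := choice coord_bound.
exists (\sum_(d < l) M d) => x; apply/c0_normP => k.
(* The residue of [m - k.+1] modulo [l], written so that natural-number subtraction does not
   truncate. *)
pose d := ((m + (l - k.+1 %% l)) %% l)%N.
have dl : (d < l)%N by rewrite ltn_mod.
have km : ((k.+1 + d) %% l)%N = m.
  rewrite /d modnDmr -modnDml addnCA subnKC; last by rewrite ltnW// ltn_mod.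
  by rewrite modnDr modn_small.
apply: le_trans ((HM d).2 x k km) _; apply: ler_wpM2r => //.
rewrite (bigD1 (Ordinal dl))//= lerDl sumr_ge0// => i _; exact: (HM i).1.
Qed.

(** The recursion solves [annihilator j * (r_j - lambda) + annihilator j.+1 * s_j = 0] (periodic
    indices), so that column [j] cancels in the weighted sum of rows. *)
Fixpoint annihilator (k : nat) : R[i] :=
  if k is j.+1 then - annihilator j * (r`_(j %% l) - lambda) / s`_(j %% l')
  else 1.

(** The sum telescopes: each new row cancels the remaining diagonal term and leaves its own. For
    [n = m] that term is zero. *)
Lemma annihilator_partial (x : c0 R) n :
  \sum_(k < n.+1) annihilator k * S x k =
  annihilator n * (r`_(n %% l) - lambda) * x n.
Proof.
elim: n => [|n IH]; first by rewrite big_ord1 BopB0 mulrA.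
have -> : \sum_(k < n.+2) annihilator k * S x k =
    \sum_(k < n.+1) annihilator k * S x k + annihilator n.+1 * S x n.+1.
  exact: big_ord_recr.
rewrite IH BopBS [annihilator n.+1 * (_ + _)]mulrDr addrA.
rewrite [annihilator n.+1 * (s`_(n %% l') * _)]mulrA.
rewrite [annihilator n.+1 * s`_(n %% l')]divfK ?nth_mod_neq0//.
rewrite !mulNr subrr add0r.
by rewrite -!mulrA.
Qed.

Lemma annihilator_range (x : c0 R) : \sum_(k < m.+1) annihilator k * S x k = 0.
Proof. by rewrite annihilator_partial modn_small// subrr mulr0 mul0r. Qed.

Lemma unit0_null : (fun k => (k == 0)%:R : R[i]^o) \in @null_seq R[i].
Proof.
apply/null_seqP; apply/(@cvgr0Pnorm_le R[i] R[i]^o) => e /ltW e0.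
by exists 1%N => // -[|k]//= _; rewrite normr0.
Qed.

(** The functional takes the value 1 at the unit vector [e], vanishes on the range and has norm at
    most [F]. Radius [(F + 1)^-1] makes [F] times the distance less than 1, so the ball around [e]
    misses the range. *)
Lemma BopB_range_not_dense : ~ dense (range S).
Proof.
pose F := \sum_(k < m.+1) `|annihilator k|.
have F0 : 0 <= F by apply: sumr_ge0.
have F1 : 0 < F + 1 by rewrite ltr_wpDl.
pose e : c0 R := C0 unit0_null.
have eps : 0 < (F + 1)^-1 by rewrite invr_gt0.
move=> /(_ (ball e (F + 1)^-1)) [||y [ye [x _ Sxy]]].
- by exists e; exact: ballxx.
- exact: ball_open.
move: ye; rewrite -Sxy -ball_normE/= => xe.
have : (1 : R[i]) <= F * `|e - S x|.
  have <- : `|\sum_(k < m.+1) annihilator k * (e - S x) k| = 1 :> R[i].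
    under eq_bigr do rewrite [(e - S x) _]/(e _ - S x _) mulrBr.
    rewrite sumrB annihilator_range subr0 big_ord_recl/= mulr1.
    rewrite big1 ?addr0 ?normr1//.
    by move=> i _; rewrite mulr0.
  apply: le_trans (ler_norm_sum _ _ _) _; rewrite mulr_suml.
  by apply: ler_sum => k _; rewrite normrM ler_wpM2l// c0_coord_le.
apply/negP; rewrite -real_ltNge ?realE ?ler01 ?mulr_ge0//.
apply: le_lt_trans (ler_wpM2l F0 (ltW xe)) _.
by rewrite ltr_pdivrMr// mul1r ltrDl.
Qed.

End band_operator_at_diagonal_entry.

Theorem theorem3p8 (R : realType) (l l' : nat)
    (r : l.-tuple R[i]) (s : l'.-tuple R[i]) :
  (1 <= l)%N -> (1 <= l')%N -> (forall j : 'I_l', tnth s j != 0) ->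
  [set` r] `<=` III1_sigma (Bop r s).
Proof.
move=> _ l'0 s0 lambda /= /(nthP 0)[m]; rewrite size_tuple => ml <-.
have [M HM] := BopB_bounded_below R l l' r s m l'0 s0 ml.
have [? ?] := bounded_below_inverse _ _ _ _ _ HM.
by split => //; exact: BopB_range_not_dense.
Qed.
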